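(* For any $\varepsilon\in\left(0,\frac{\pi}{6}\right)$, there exists a nonempty compact subset $X\subseteq S^1$ with $d_{\mathrm{H}}(S^1,X)=\frac{\pi}{3}+\varepsilon$ and $d_{\mathrm{GH}}(S^1,X)=\frac{\pi}{3}<d_{\mathrm{H}}(S^1,X)$.
   Context: $S^1$ is the circle of circumference $2\pi$ with its geodesic (arc-length) metric, and $X$ carries the restricted metric. $d_{\mathrm{H}}$ is the Hausdorff distance between subsets of $S^1$ and $d_{\mathrm{GH}}$ is the Gromov--Hausdorff distance. *)

(* Defs.v *)
From HB Require Import structures.
From mathcomp Require Import all_boot all_order all_algebra.
From mathcomp Require Import all_classical all_reals all_analysis.
From mathcomp Require Import lra.

Set Implicit Arguments.
Unset Strict Implicit.
Unset Printing Implicit Defensive.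

Import Order.TTheory GRing.Theory Num.Theory.

Local Open Scope classical_set_scope.
Local Open Scope ring_scope.

(* The circle of circumference 2 * pi, i.e. R / 2 pi Z, presented by the
   representatives of its points in [0, 2 * pi[. Its topology is the one induced
   by the arc-length distance below, not the one inherited from R. *)
Record circle (R : realType) := Circle {
  angle : R;
  angle_itv : (0 <= angle) && (angle < 2 * pi) }.

HB.instance Definition _ (R : realType) := [isSub for @angle R].
HB.instance Definition _ (R : realType) := [Choice of circle R by <:].

Section arc_length.
Context {R : realType}.
Implicit Types x y z : circle R.

(* The length of the shorter of the two arcs joining x and y. *)
Definition arc_dist x y : R :=
  Num.min `|angle x - angle y| (2 * pi - `|angle x - angle y|).

Lemma arc_distxx x : arc_dist x x = 0.
Proof.
by rewrite /arc_dist subrr normr0 subr0 min_l// mulr_ge0// pi_ge0.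
Qed.

Lemma arc_dist_sym x y : arc_dist x y = arc_dist y x.
Proof. by rewrite /arc_dist distrC. Qed.

Let distE (s t : R) : `|s - t| = if s <= t then t - s else s - t.
Proof. by case: lerP. Qed.

Lemma arc_dist_positivity x y : arc_dist x y = 0 -> x = y.
Proof.
move=> xy; apply: val_inj; move: xy => /=.
have /andP[x0 x2] := angle_itv x; have /andP[y0 y2] := angle_itv y.
by rewrite /arc_dist distE; case: lerP => ?; case: lerP => ?; lra.
Qed.

Lemma arc_dist_triangle y x z : arc_dist x z <= arc_dist x y + arc_dist y z.
Proof.
have /andP[x0 x2] := angle_itv x; have /andP[y0 y2] := angle_itv y.
have /andP[z0 z2] := angle_itv z.
rewrite /arc_dist !distE !minEle.
by case: (lerP (angle x) (angle z)) => ?; case: (lerP (angle x) (angle y)) => ?;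
   case: (lerP (angle y) (angle z)) => ?; do 3! case: ifPn; rewrite -?ltNge; lra.
Qed.

HB.instance Definition _ := isMetric.Build R (circle R)
  arc_distxx arc_dist_positivity arc_dist_sym arc_dist_triangle.

End arc_length.

Section distances.
Context {R : realType}.
Local Open Scope ereal_scope.

Definition dist_to (M : metricType R) (A : set M) (x : M) : \bar R :=
  ereal_inf [set (mdist x a)%:E | a in A].

(* Extended-real valued, so that no boundedness assumption is needed; to be used
   on nonempty sets only. *)
Definition hausdorff_dist (M : metricType R) (A B : set M) : \bar R :=
  maxe (ereal_sup [set dist_to B a | a in A])
       (ereal_sup [set dist_to A b | b in B]).

Definition isometric_on (M Z : metricType R) (A : set M) (f : M -> Z) : Prop :=
  forall x y, A x -> A y -> mdist (f x) (f y) = mdist x y.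

(* The Gromov-Hausdorff distance between the metric spaces A and B, each with
   the metric restricted from its ambient space: the infimum of the Hausdorff
   distances between isometric copies of A and B in a common metric space Z.
   The values of f outside A and of g outside B play no role. *)
Definition gromov_hausdorff_dist (M N : metricType R) (A : set M) (B : set N) :
    \bar R :=
  ereal_inf [set r | exists (Z : metricType R) (f : M -> Z) (g : N -> Z),
    [/\ isometric_on A f, isometric_on B g &
        r = hausdorff_dist (f @` A) (g @` B)]].

End distances.

(* Main.v *)
(* Take X = {0, pi/3, 2pi/3, 4pi/3 - 2 eps}, whose longest gap is 2pi/3 + 2 eps.

   Upper bound: cut the circle into three arcs of length 2pi/3 and let them
   correspond to 0, pi/3 and 2pi/3; adding the single pair
   (2pi - 2 eps, 4pi/3 - 2 eps) keeps the distortion at most 2pi/3.  A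
   correspondence of distortion at most 2r turns the disjoint union of the two
   spaces into a metric space, two corresponding points being at distance r.

   Lower bound (a discrete Borsuk-Ulam argument): if the distance were smaller
   than pi/3, there would be a map f from the circle to X of distortion
   d < 2pi/3.  Antipodal points u, v have images more than pi/3 apart, and
   nearby points have images less than 2pi/3 apart; since X lies in an arc of
   length 4pi/3, the latter also holds for the difference of the angles.  These
   facts force the order of the angles of f u and f v to remain the same when
   (u, v) moves a little, hence along a whole half turn, which exchanges u and
   v: a contradiction. *)
From HB Require Import structures.
Require Import Defs.
From mathcomp Require Import all_boot all_order all_algebra.
From mathcomp Require Import all_classical all_reals all_analysis.
From mathcomp Require Import lra.

Import Order.TTheory GRing.Theory Num.Theory.

Local Open Scope classical_set_scope.
Local Open Scope ring_scope.

(** * Gluing two metric spaces along a correspondence *)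

Record partial_corr {R : realType} (M N : metricType R) (r : R) := PartialCorr {
  corr :> M -> N -> Prop;
  corr_radius_gt0 : 0 < r;
  corr_neq0 : exists a b, corr a b;
  corr_distortion : forall a a' b b', corr a b -> corr a' b' ->
    `|mdist a a' - mdist b b'| <= 2 * r }.

Arguments corr {R M N r} _ _ _.
Arguments corr_radius_gt0 {R M N r} _.
Arguments corr_neq0 {R M N r} _.
Arguments corr_distortion {R M N r} _ {a a' b b'}.

(** The sum type is tagged with [c] because its metric depends on the correspondence. *)
Definition glue {R : realType} {M N : metricType R} {r : R}
  (c : partial_corr M N r) : Type := (M + N)%type.

Section glue.
Context {R : realType} {M N : metricType R} {r : R} (c : partial_corr M N r).

HB.instance Definition _ := Choice.copy (glue c) (M + N)%type.

(** Lengths of the paths that cross once between the spaces, at a related pair and at cost [r]. *)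
Definition bridges x y : set R :=
  [set t | exists a b, c a b /\ t = mdist x a + r + mdist b y].

Definition bridge_dist x y : R := inf (bridges x y).

Lemma bridges_neq0 x y : bridges x y !=set0.
Proof. by have [a [b ab]] := corr_neq0 c; exists (mdist x a + r + mdist b y), a, b. Qed.

Lemma bridges_lbound x y : lbound (bridges x y) r.
Proof.
move=> _ [a [b [_ ->]]].
by have := mdist_ge0 x a; have := mdist_ge0 b y; lra.
Qed.

Lemma bridge_dist_ge x y : r <= bridge_dist x y.
Proof. exact: lb_le_inf (bridges_neq0 x y) (bridges_lbound x y). Qed.

Lemma bridge_dist_le {a b} x y :
  c a b -> bridge_dist x y <= mdist x a + r + mdist b y.
Proof. by move=> ab; apply: ge_inf; [exists r; exact: bridges_lbound|exists a, b]. Qed.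

Lemma le_bridge_dist x y t :
  (forall a b, c a b -> t <= mdist x a + r + mdist b y) -> t <= bridge_dist x y.
Proof.
move=> h; apply: lb_le_inf (bridges_neq0 x y) _ => _ [a [b [ab ->]]].
exact: h.
Qed.

Definition glue_dist (z w : glue c) : R :=
  match z, w with
  | inl x, inl x' => mdist x x'
  | inr y, inr y' => mdist y y'
  | inl x, inr y | inr y, inl x => bridge_dist x y
  end.

Lemma glue_distxx z : glue_dist z z = 0.
Proof. by case: z => z; exact: mdistxx. Qed.

Lemma glue_dist_sym z w : glue_dist z w = glue_dist w z.
Proof. by case: z w => [x|y] [x'|y'] //=; exact: metric_sym. Qed.

Lemma glue_dist_positivity z w : glue_dist z w = 0 -> z = w.
Proof.
have r0 := corr_radius_gt0 c.
case: z w => [x|y] [x'|y'] /=; try by move/mdist_positivity ->.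
- by move=> xy'0; have := bridge_dist_ge x y'; rewrite xy'0 leNgt r0.
- by move=> x'y0; have := bridge_dist_ge x' y; rewrite x'y0 leNgt r0.
Qed.

Lemma bridge_dist_lipl x x' y : bridge_dist x y <= mdist x x' + bridge_dist x' y.
Proof.
rewrite -lerBlDl; apply: le_bridge_dist => a b ab.
by have := bridge_dist_le x y ab; have := metric_triangle x x' a; lra.
Qed.

Lemma bridge_dist_lipr x y y' : bridge_dist x y <= bridge_dist x y' + mdist y' y.
Proof.
rewrite -lerBlDr; apply: le_bridge_dist => a b ab.
by have := bridge_dist_le x y ab; have := metric_triangle b y' y; lra.
Qed.

(** A detour through the other space crosses twice, and this cost [2 * r] pays for the distortion,
    as [mdist a a'] exceeds [mdist b b'] by at most [2 * r]. *)
Lemma mdistl_le_bridge x x' y : mdist x x' <= bridge_dist x y + bridge_dist x' y.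
Proof.
rewrite -lerBlDr; apply: le_bridge_dist => a b ab.
rewrite lerBlDr -lerBlDl; apply: le_bridge_dist => a' b' ab'.
have := metric_triangle x a x'; have := metric_triangle a a' x'.
have := metric_triangle b y b'; have := corr_distortion c ab ab'.
by rewrite (metric_sym a' x') (metric_sym y b') ler_norml; lra.
Qed.

Lemma mdistr_le_bridge x y y' : mdist y y' <= bridge_dist x y + bridge_dist x y'.
Proof.
rewrite -lerBlDr; apply: le_bridge_dist => a b ab.
rewrite lerBlDr -lerBlDl; apply: le_bridge_dist => a' b' ab'.
have := metric_triangle y b y'; have := metric_triangle b b' y'.
have := metric_triangle a x a'; have := corr_distortion c ab ab'.
by rewrite (metric_sym y b) (metric_sym a x) ler_norml; lra.
Qed.

Lemma glue_dist_triangle w z v : glue_dist z v <= glue_dist z w + glue_dist w v.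
Proof.
case: z w v => [x|y] [x'|y'] [x''|y''] /=; try exact: metric_triangle.
- exact: bridge_dist_lipl.
- exact: mdistl_le_bridge.
- exact: bridge_dist_lipr.
- by rewrite addrC metric_sym; exact: bridge_dist_lipl.
- exact: mdistr_le_bridge.
- by rewrite addrC (metric_sym y y'); exact: bridge_dist_lipr.
Qed.

HB.instance Definition _ := isMetric.Build R (glue c)
  glue_distxx glue_dist_positivity glue_dist_sym glue_dist_triangle.

End glue.

(** * Upper bounds on the two distances *)

Lemma ge_hausdorff_dist {R : realType} {Z : metricType R} (A B : set Z) (r : R) :
  (forall a, A a -> exists2 b, B b & mdist a b <= r) ->
  (forall b, B b -> exists2 a, A a & mdist a b <= r) ->
  (hausdorff_dist A B <= r%:E)%E.
Proof.
move=> AB BA; rewrite /hausdorff_dist ge_max; apply/andP; split;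
  apply: ge_ereal_sup => _ [z Az <-].
- have [b Bb ab] := AB _ Az; apply: ge_ereal_inf.
  by exists (mdist z b)%:E; [exists b|rewrite lee_fin].
- have [a Aa ab] := BA _ Az; apply: ge_ereal_inf.
  by exists (mdist z a)%:E; [exists a|rewrite lee_fin metric_sym].
Qed.

(** The common space is [glue c]: both injections are isometric by construction, and a related pair
    bridges itself at length [r]. *)
Lemma gromov_hausdorff_dist_le {R : realType} {M N : metricType R}
    (A : set M) (B : set N) (r : R) (c : partial_corr M N r) :
  (forall a, A a -> exists2 b, B b & c a b) ->
  (forall b, B b -> exists2 a, A a & c a b) ->
  (gromov_hausdorff_dist A B <= r%:E)%E.
Proof.
move=> AB BA.
have ab_le a b : c a b -> bridge_dist c a b <= r.
  by move=> ab; have := bridge_dist_le c a b ab; rewrite !mdistxx addr0 add0r.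
apply: ge_ereal_inf; exists (hausdorff_dist (inl @` A : set (glue c)) (inr @` B)).
  by exists (glue c), inl, inr; split.
apply: ge_hausdorff_dist => [_ [a Aa <-]|_ [b Bb <-]].
- by have [b Bb ab] := AB _ Aa; exists (inr b); [exists b|exact: ab_le].
- by have [a Aa ab] := BA _ Bb; exists (inl a); [exists a|exact: ab_le].
Qed.

(** * Angles and rotations of the circle *)

Lemma angle_ge0 {R : realType} (x : circle R) : 0 <= angle x.
Proof. by have /andP[] := angle_itv x. Qed.

Lemma angle_lt2pi {R : realType} (x : circle R) : angle x < 2 * pi.
Proof. by have /andP[] := angle_itv x. Qed.

Lemma circle_mdistE {R : realType} (x y : circle R) :
  mdist x y = if `|angle x - angle y| <= pi then `|angle x - angle y|
              else 2 * pi - `|angle x - angle y|.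
Proof.
rewrite [LHS](_ : _ = Num.min `|angle x - angle y| (2 * pi - `|angle x - angle y|))//.
by rewrite minEle; case: ifPn; case: ifPn; rewrite -?ltNge; lra.
Qed.

(** Without minima or absolute values, splitting on the tests leaves linear goals only. *)
Lemma mdist_angleE {R : realType} (x y : circle R) :
  mdist x y = let e := if angle x <= angle y then angle y - angle x
                       else angle x - angle y in
              if e <= pi then e else 2 * pi - e.
Proof.
by rewrite circle_mdistE; case: (lerP (angle x) (angle y)).
Qed.

Lemma circle0_itv {R : realType} : (0 <= 0 :> R) && (0 < 2 * pi :> R).
Proof. by rewrite lexx mulr_gt0// pi_gt0. Qed.

Definition circle_pt {R : realType} (t : R) : circle R :=
  insubd (Circle circle0_itv) t.

Lemma angle_circle_pt {R : realType} (t : R) :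
  0 <= t -> t < 2 * pi -> angle (circle_pt t) = t.
Proof. by move=> t0 t2; rewrite /circle_pt [LHS]val_insubd t0 t2. Qed.

(* Subtracting at most one turn reduces t correctly only for 0 <= t < 4 * pi. *)
Definition turn {R : realType} (t : R) : circle R :=
  circle_pt (if t < 2 * pi then t else t - 2 * pi).

Lemma angle_turn {R : realType} (t : R) : 0 <= t -> t < 4 * pi ->
  angle (turn t) = if t < 2 * pi then t else t - 2 * pi.
Proof. by rewrite /turn => t0 t4; case: ltP => t2; rewrite angle_circle_pt//; lra. Qed.

Lemma mdist_turn_le {R : realType} (s t : R) :
  0 <= s -> s <= t -> t < 4 * pi -> mdist (turn s) (turn t) <= t - s.
Proof.
move=> s0 st t4; have p0 := pi_gt0 R.
rewrite mdist_angleE !angle_turn//; [|lra|lra].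
by case: (ltP s (2 * pi)) => ?; case: (ltP t (2 * pi)) => ? /=;
  case: ifPn; case: ifPn;
  rewrite -?ltNge; lra.
Qed.

Lemma mdist_turn_antipode {R : realType} (t : R) :
  0 <= t -> t < 3 * pi -> mdist (turn t) (turn (t + pi)) = pi.
Proof.
move=> t0 t3; have p0 := pi_gt0 R.
rewrite mdist_angleE !angle_turn//; [|lra|lra|lra].
by case: (ltP t (2 * pi)) => ?; case: (ltP (t + pi) (2 * pi)) => ? /=;
  case: ifPn; case: ifPn;
  rewrite -?ltNge; lra.
Qed.

(** * Distortion of maps from the circle into an arc of length [4 * pi / 3] *)

Section distortion.
Context {R : realType} {f : circle R -> circle R} {d : R}.
Context (f_le : forall x, angle (f x) <= 4 * pi / 3)
  (f_distortion : forall x y, `|mdist x y - mdist (f x) (f y)| <= d).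

Let f_far x y : d < mdist x y - pi / 3 -> pi / 3 < `|angle (f x) - angle (f y)|.
Proof.
have := f_distortion x y; rewrite ler_norml circle_mdistE (circle_mdistE (f x)).
by case: (ifPn (_ <= _)) => _; case: ifPn; rewrite -?ltNge; lra.
Qed.

(** The images are less than [2 * pi / 3] apart. An angle difference above [pi] would then exceed
    [4 * pi / 3], which [f_le] excludes. *)
Let f_near x y : mdist x y + d < 2 * pi / 3 ->
  `|angle (f x) - angle (f y)| < 2 * pi / 3.
Proof.
have fx := f_le x; have fy := f_le y.
have fx0 := angle_ge0 (f x); have fy0 := angle_ge0 (f y).
have := f_distortion x y; rewrite ler_norml (circle_mdistE (f x)).
by case: (ger0P (_ - _)) => ?; case: ifPn; rewrite -?ltNge; lra.
Qed.

(** Suppose the order flips. The crossed pair [u], [v'] is still at distance at least [pi - delta],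
    so [f u] and [f v'] also differ by more than [pi / 3] in angle. If [f v'] is the larger, then
    [f u'] exceeds [f u] by two such gaps; otherwise [f v] exceeds [f v'] by two. Either contradicts
    [f_near]. *)
Lemma antipodal_order_stable delta u v u' v' :
  delta + d < 2 * pi / 3 -> mdist u v = pi -> mdist u' v' = pi ->
  mdist u u' <= delta -> mdist v v' <= delta ->
  angle (f u) < angle (f v) -> angle (f u') < angle (f v').
Proof.
move=> deltad uv uv' uu' vv' fuv; rewrite ltNge; apply/negP => fvu'.
have delta0 : 0 <= delta := le_trans (mdist_ge0 u u') uu'.
have := metric_triangle u v' v; rewrite (metric_sym v') => tri.
have /f_far : d < mdist u v - pi / 3 by lra.
have /f_far : d < mdist u' v' - pi / 3 by lra.
have /f_far : d < mdist u v' - pi / 3 by lra.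
have /f_near : mdist u u' + d < 2 * pi / 3 by lra.
have /f_near : mdist v v' + d < 2 * pi / 3 by lra.
rewrite !ltr_norml !ltr_normr => /andP[? ?] /andP[? ?].
by do 3!case/orP=> ?; lra.
Qed.

Lemma distortion_ge : 2 * pi / 3 <= d.
Proof.
rewrite leNgt; apply/negP => dlt.
have p0 := pi_gt0 R.
(* [N.+1] exceeds the truncated quotient, so [N.+1] equal steps make exactly a half turn, each
   shorter than [2 * pi / 3 - d]. *)
pose N := Num.truncn (pi / (2 * pi / 3 - d)).
pose delta : R := pi / N.+1%:R.
have N0 : (0 : R) < N.+1%:R by [].
have delta0 : 0 < delta by rewrite divr_gt0.
have deltad : delta + d < 2 * pi / 3.
  rewrite -ltrBrDr ltr_pdivrMr// mulrC -ltr_pdivrMr ?truncnS_gt//; lra.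
have Ndelta : N.+1%:R * delta = pi by rewrite mulrC divfK// gt_eqF.
have le_pi i : (i <= N.+1)%N -> 0 <= i%:R * delta <= pi.
  by move=> iN; rewrite -Ndelta ler_pM2r// ler_nat iN mulr_ge0// ltW.
have step i : (i <= N)%N ->
    [/\ mdist (turn (i%:R * delta)) (turn (i%:R * delta + pi)) = pi,
        mdist (turn (i.+1%:R * delta)) (turn (i.+1%:R * delta + pi)) = pi,
        mdist (turn (i%:R * delta)) (turn (i.+1%:R * delta)) <= delta &
        mdist (turn (i%:R * delta + pi)) (turn (i.+1%:R * delta + pi)) <= delta].
  move=> iN; have := le_pi i (leqW iN); have := le_pi i.+1 iN.
  have -> : i.+1%:R * delta = i%:R * delta + delta by rewrite -natr1 mulrDl mul1r.
  move: (i%:R * delta) => t t1 t0; split.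
  - by apply: mdist_turn_antipode; lra.
  - by apply: mdist_turn_antipode; lra.
  - by rewrite (le_trans (mdist_turn_le _ _ _ _ _))//; lra.
  - by rewrite (le_trans (mdist_turn_le _ _ _ _ _))//; lra.
(* Whichever strict order holds at the pair of angles [0] and [pi], it propagates step by step along
   the half turn. *)
have up i : (i <= N.+1)%N -> angle (f (turn 0)) < angle (f (turn pi)) ->
    angle (f (turn (i%:R * delta))) < angle (f (turn (i%:R * delta + pi))).
  elim: i => [|i IH] iN f0; first by rewrite mul0r add0r.
  have [? ? ? ?] := step i iN.
  exact: (antipodal_order_stable delta) (IH (ltnW iN) f0).
have down i : (i <= N.+1)%N -> angle (f (turn pi)) < angle (f (turn 0)) ->
    angle (f (turn (i%:R * delta + pi))) < angle (f (turn (i%:R * delta))).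
  elim: i => [|i IH] iN f0; first by rewrite mul0r add0r.
  have [? ? ? ?] := step i iN.
  by apply: (antipodal_order_stable delta) (IH (ltnW iN) f0); rewrite // metric_sym.
(* The half turn ends at the initial pair with its two points exchanged. *)
have turn2pi : turn (pi + pi) = turn (0 : R).
  rewrite /turn ifF ?ifT; [congr circle_pt; lra|lra|].
  by apply/negbTE; rewrite -leNgt; lra.
have := up N.+1 (leqnn _); have := down N.+1 (leqnn _).
rewrite !Ndelta turn2pi => dn u.
have [lt0pi|ltpi0|f0pi] := ltrgtP (angle (f (turn 0))) (angle (f (turn pi))).
- by have := u lt0pi; lra.
- by have := dn ltpi0; lra.
(* Equal angles are impossible too: the images of antipodes differ by more than [pi / 3]. *)
have := f_far (turn 0) (turn pi); rewrite f0pi subrr normr0.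
have := @mdist_turn_antipode R 0; rewrite add0r => -> //; lra.
Qed.

End distortion.

(** If each point of the circle lies within [e < pi / 3] of [X] in the common space, choosing such a
    neighbour gives a map of distortion at most [2 * e], against [distortion_ge]. *)
Lemma gromov_hausdorff_dist_circle_ge {R : realType} (X : set (circle R)) :
  (forall x, X x -> angle x <= 4 * pi / 3) ->
  ((pi / 3)%:E <= gromov_hausdorff_dist [set: circle R] X)%E.
Proof.
move=> X_le; apply: le_ereal_inf_tmp => _ [Z [i [j [iE jE ->]]]].
rewrite leNgt; apply/negP; rewrite /hausdorff_dist gt_max => /andP[+ _].
set h := ereal_sup _ => h_lt.
(* The midpoint of [h] and [pi / 3] when [h] is finite, and [0] when it is [-oo]. *)
have [e e_lt h_le] : exists2 e : R, e < pi / 3 & (h < e%:E)%E.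
  case: h h_lt => [h|//|_]; last by exists 0; rewrite ?ltNyr// divr_gt0 ?pi_gt0.
  by rewrite lte_fin => h_lt; exists ((h + pi / 3) / 2); rewrite ?lte_fin; lra.
have near_X x : exists y, X y /\ mdist (i x) (j y) < e.
  have : (dist_to (j @` X) (i x) < e%:E)%E.
    apply: le_lt_trans h_le; apply: ereal_sup_ubound.
    by exists (i x) => //; exists x.
  by case/ereal_inf_lt => _ [_ [y Xy <-] <-]; rewrite lte_fin; exists y.
have [f f_near] := choice near_X.
have : 2 * pi / 3 <= 2 * e; last by lra.
apply: (@distortion_ge _ f) => [x|x y]; first by apply: X_le; case: (f_near x).
have [Xx xe] := f_near x; have [Xy ye] := f_near y.
rewrite -(iE x y)// -(jE _ _ Xx Xy).
move: xe ye; move: (i x) (i y) (j (f x)) (j (f y)) => a b a' b' aa' bb'.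
have := metric_triangle a a' b; have := metric_triangle a' b' b.
have := metric_triangle a' a b'; have := metric_triangle a b b'.
by rewrite (metric_sym a' a) (metric_sym b' b) ler_norml; lra.
Qed.

(** * The four-point subset and its correspondence with the circle *)

Section four_points.
Context {R : realType} (eps : R) (heps : 0 < eps < pi / 6).

Definition four_points : set (circle R) :=
  [set x | [\/ angle x = 0, angle x = pi / 3, angle x = 2 * pi / 3 |
               angle x = 4 * pi / 3 - 2 * eps]].

Lemma compact_four_points : compact four_points.
Proof.
apply: finite_compact.
apply: (@sub_finite_set _ _ [set circle_pt 0; circle_pt (pi / 3);
  circle_pt (2 * pi / 3); circle_pt (4 * pi / 3 - 2 * eps)]).
  have angleK (x : circle R) : circle_pt (angle x) = x.
    by apply: val_inj; rewrite /= angle_circle_pt ?angle_ge0 ?angle_lt2pi.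
  move=> x /= Xx; rewrite -(angleK x).
  by case: Xx => ->; rewrite /=; tauto.
by rewrite !finite_setU.
Qed.

Lemma hausdorff_dist_four_points :
  hausdorff_dist [set: circle R] four_points = (pi / 3 + eps)%:E.
Proof.
have p0 := pi_gt0 R; have /andP[e0 e6] := heps.
apply/eqP; rewrite eq_le; apply/andP; split.
  apply: ge_hausdorff_dist => [x _|x _]; last by exists x; rewrite // mdistxx; lra.
  have x0 := angle_ge0 x; have x2 := angle_lt2pi x.
  have near (t : R) : 0 <= t -> t < 2 * pi ->
      [\/ t = 0, t = pi / 3, t = 2 * pi / 3 | t = 4 * pi / 3 - 2 * eps] ->
      `|angle x - t| <= pi / 3 + eps \/ 2 * pi - `|angle x - t| <= pi / 3 + eps ->
      exists2 b, four_points b & mdist x b <= pi / 3 + eps.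
    move=> t0 t2 ht xt; exists (circle_pt t).
      by rewrite /four_points /= angle_circle_pt.
    rewrite circle_mdistE angle_circle_pt//.
    by case: xt => ?; case: ifPn; rewrite -?ltNge; lra.
  (* The cuts are midpoints of the gaps, except that [pi] replaces [pi - eps], which the slack [eps]
     allows. *)
  have [x1|x1] := lerP (angle x) (pi / 6).
    by apply: (near 0); [lra|lra|exact: Or41|left; rewrite ler_norml; lra].
  have [x3|x3] := lerP (angle x) (pi / 2).
    by apply: (near (pi / 3)); [lra|lra|exact: Or42|left; rewrite ler_norml; lra].
  have [x4|x4] := lerP (angle x) pi.
    by apply: (near (2 * pi / 3)); [lra|lra|exact: Or43|left; rewrite ler_norml; lra].
  have [x5|x5] := lerP (angle x) (5 * pi / 3 - eps).
    by apply: (near (4 * pi / 3 - 2 * eps));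
       [lra|lra|exact: Or44|left; rewrite ler_norml; lra].
  by apply: (near 0); [lra|lra|exact: Or41|right; rewrite ger0_norm; lra].
rewrite /hausdorff_dist le_max; apply/orP; left.
(* The midpoint of the longest gap, between [4 * pi / 3 - 2 * eps] and a full turn, is the farthest
   point. *)
apply: (@le_trans _ _ (dist_to four_points (circle_pt (5 * pi / 3 - eps)))).
  apply: le_ereal_inf_tmp => _ [x Xx <-].
  rewrite lee_fin mdist_angleE angle_circle_pt; [|lra|lra].
  by case: Xx => ->; case: ifPn => ? /=; case: ifPn; rewrite -?ltNge; lra.
by apply: ereal_sup_ubound; exists (circle_pt (5 * pi / 3 - eps)).
Qed.

(** The point [2 * pi - 2 * eps] of the third arc gets a second partner, at distance
    [2 * pi / 3 + 2 * eps] from [0]. Lying [2 * eps] before the origin, it is at least [2 * eps]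
    away from the first arc, just enough for the distortion bound. *)
Definition four_points_rel (x y : circle R) : Prop :=
  [\/ angle x < 2 * pi / 3 /\ angle y = 0,
      2 * pi / 3 <= angle x < 4 * pi / 3 /\ angle y = pi / 3,
      4 * pi / 3 <= angle x /\ angle y = 2 * pi / 3 |
      angle x = 2 * pi - 2 * eps /\ angle y = 4 * pi / 3 - 2 * eps].

(** Within one arc distances stay below [2 * pi / 3] and the partners coincide. Between two arcs
    distances lie in [[0, pi]] and the partners are [pi / 3] or [2 * pi / 3] apart. The added pair
    is checked against each arc. *)
Lemma four_points_rel_distortion x x' y y' :
  four_points_rel x y -> four_points_rel x' y' ->
  `|mdist x x' - mdist y y'| <= 2 * (pi / 3).
Proof.
move=> xy xy'; wlog xx' : x x' y y' xy xy' / angle x <= angle x'.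
  move=> dist_le; have [|/ltW] := lerP (angle x) (angle x'); first exact: dist_le.
  by rewrite (metric_sym x) (metric_sym y); exact: dist_le.
have p0 := pi_gt0 R; have /andP[e0 e6] := heps.
have x0 := angle_ge0 x; have x'2 := angle_lt2pi x'.
rewrite (mdist_angleE x) xx' /= ler_norml.
case: xy => [[hx hy]|[/andP[hx1 hx2] hy]|[hx hy]|[hx hy]];
case: xy' => [[hx' hy']|[/andP[hx'1 hx'2] hy']|[hx' hy']|[hx' hy']].
all: try by exfalso; lra.
all: rewrite mdist_angleE.
all: case: (lerP (angle y) (angle y')); rewrite hy hy' => ? /=;
  try by exfalso; lra.
all: do 2!(case: ifPn; rewrite -?ltNge => ?; try by exfalso; lra).
all: lra.
Qed.

End four_points.

Theorem theorem4 (R : realType) (eps : R) (heps : 0 < eps < pi / 6) :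
  exists X : set (circle R),
    [/\ X !=set0,
        compact X,
        hausdorff_dist [set: circle R] X = (pi / 3 + eps)%:E,
        gromov_hausdorff_dist [set: circle R] X = (pi / 3)%:E &
        (gromov_hausdorff_dist [set: circle R] X
           < hausdorff_dist [set: circle R] X)%E].
Proof.
have p0 := pi_gt0 R; have /andP[e0 e6] := heps.
have third_gt0 : 0 < pi / 3 :> R by lra.
have rel0 : four_points_rel eps (circle_pt 0) (circle_pt 0).
  by apply: Or41; rewrite angle_circle_pt//; lra.
pose c := PartialCorr _ _ _ _ (four_points_rel eps) third_gt0
  (ex_intro _ _ (ex_intro _ _ rel0)) (four_points_rel_distortion eps heps).
have dH := hausdorff_dist_four_points eps heps.
have dGH : gromov_hausdorff_dist [set: circle R] (four_points eps) = (pi / 3)%:E.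
  apply/eqP; rewrite eq_le; apply/andP; split; last first.
    by apply: gromov_hausdorff_dist_circle_ge => x [] ->; lra.
  apply: (gromov_hausdorff_dist_le _ _ _ c) => [x _|y Xy].
    have [x1|x1] := ltP (angle x) (2 * pi / 3).
      exists (circle_pt 0); last by apply: Or41; rewrite angle_circle_pt//; lra.
      by apply: Or41; rewrite angle_circle_pt//; lra.
    have [x2|x2] := ltP (angle x) (4 * pi / 3).
      exists (circle_pt (pi / 3)); last first.
        by apply: Or42; rewrite x1 x2 angle_circle_pt//; lra.
      by apply: Or42; rewrite angle_circle_pt//; lra.
    exists (circle_pt (2 * pi / 3)); last first.
      by apply: Or43; rewrite x2 angle_circle_pt//; lra.
    by apply: Or43; rewrite angle_circle_pt//; lra.
  (* The first three points are matched with the initial points of their arcs, the last with its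
     added partner. *)
  case: Xy => y_eq.
  - by exists (circle_pt 0) => //; apply: Or41; rewrite angle_circle_pt//; lra.
  - exists (circle_pt (2 * pi / 3)) => //.
    by apply: Or42; rewrite angle_circle_pt; [split=> //| |]; lra.
  - exists (circle_pt (4 * pi / 3)) => //.
    by apply: Or43; rewrite angle_circle_pt//; lra.
  - exists (circle_pt (2 * pi - 2 * eps)) => //.
    by apply: Or44; rewrite angle_circle_pt//; lra.
exists (four_points eps); split.
- by exists (circle_pt 0); apply: Or41; rewrite angle_circle_pt//; lra.
- exact: compact_four_points.
- exact: dH.
- exact: dGH.
- by rewrite dGH dH lte_fin; lra.
Qed.
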